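(* Let $C$ be a finite simple skew brace which is not a trivial skew brace, let $T$ be a non-trivial finite abelian group, and let $\chi:(C,\circ)\to T$ be a surjective group homomorphism. Then the skew brace $\mathsf{K}_T(C,\chi)$ is simple.
   Context: A skew brace is a triple $(B,+,\circ)$ such that $(B,+)$ and $(B,\circ)$ are groups (neither assumed abelian) on the same set and $a\circ(b+c)=a\circ b-a+a\circ c$ for all $a,b,c\in B$. The two identity elements coincide and are denoted $0$. Its lambda map is the group homomorphism $\lambda^B:(B,\circ)\to\mathrm{Aut}(B,+)$, $\lambda^B_a(b)=-a+a\circ b$. The skew brace is trivial if $\lambda^B_a=\mathrm{id}$ for all $a$, equivalently $a\circ b=a+b$ for all $a,b$. An ideal is a subgroup $I\le(B,+)$ with $I\trianglelefteq(B,+)$, $I\trianglelefteq(B,\circ)$ and $\lambda^B_a(I)=I$ for all $a\in B$. A non-zero skew brace is simple if its only ideals are $0$ and $B$. The kernel--wreath skew brace $\mathsf{K}_T(C,\chi)$: write $A=(C,+)$, $R=(C,\circ)$, let $\pi:R\to A$ be the identity map on the underlying set of $C$, and let $\Omega$ be the underlying set of $T$. The group $T$ acts on $R^\Omega$ by ${}^u(r_x)_{x\in\Omega}=(r_{u^{-1}x})_{x\in\Omega}$; let $W=R^\Omega\rtimes T$, with $(r,u)(s,v)=(r\,{}^us,uv)$. The group $W$ acts on $A^\Omega$ by $(r,u)\cdot(a_x)_x=\big(\pi(r_x)+\lambda^C_{r_x}(a_{u^{-1}x})\big)_x$. Let $\varepsilon:W\to T$ be the homomorphism $\varepsilon((r_x)_x,u)=\big(\prod_{x\in\Omega}\chi(r_x)\big)u$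 and $G=\ker\varepsilon$. The group $G$ acts regularly on $A^\Omega$, and $\Pi:G\to A^\Omega$, $\Pi((r_x)_x,u)=(\pi(r_x))_x$ (the image of $0$ under the action), is a bijection. Then $\mathsf{K}_T(C,\chi)$ is the skew brace with underlying set $A^\Omega$, whose addition is that of the direct product $A^\Omega$ and whose multiplication is the group structure of $G$ transported along $\Pi$. *)

(* Defs.v *)
From HB Require Import structures.
From mathcomp Require Import all_boot all_fingroup.

Set Implicit Arguments.
Unset Strict Implicit.
Unset Printing Implicit Defensive.

Local Open Scope group_scope.

Declare Scope skew_scope.
Delimit Scope skew_scope with SB.

(* The second operation, usually written with a circle, is denoted by [*] in
   [skew_scope]. The two groups have a priori distinct identity elements [szero]
   and [sone]; [sone_szero] below shows that they coincide. *)
HB.mixin Record isSkewBrace B of Choice B := {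
  sadd : B -> B -> B;
  szero : B;
  sopp : B -> B;
  smul : B -> B -> B;
  sone : B;
  sinv : B -> B;
  saddA : associative sadd;
  sadd0r : left_id szero sadd;
  saddr0 : right_id szero sadd;
  saddNr : left_inverse szero sopp sadd;
  saddrN : right_inverse szero sopp sadd;
  smulA : associative smul;
  smul1r : left_id sone smul;
  smulr1 : right_id sone smul;
  smulVr : left_inverse sone sinv smul;
  smulrV : right_inverse sone sinv smul;
  smulD : forall a b c,
    smul a (sadd b c) = sadd (sadd (smul a b) (sopp a)) (smul a c)
}.

#[short(type="skewBraceType")]
HB.structure Definition SkewBrace := {B of isSkewBrace B & Choice B}.

#[short(type="finSkewBraceType")]
HB.structure Definition FinSkewBrace := {B of isSkewBrace B & Finite B}.

Notation "0" := (szero) : skew_scope.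
Notation "x + y" := (sadd x y) : skew_scope.
Notation "- x" := (sopp x) : skew_scope.
Notation "x - y" := (sadd x (sopp y)) : skew_scope.
Notation "x * y" := (smul x y) : skew_scope.

(* Copies of the carrier bearing, as a multiplicatively written MathComp group,
   the group (B, +), resp. the group (B, o). *)
Definition addG (B : Type) : Type := B.
Definition mulG (B : Type) : Type := B.

HB.instance Definition _ (B : choiceType) := Choice.copy (addG B) B.
HB.instance Definition _ (B : choiceType) := Choice.copy (mulG B) B.
HB.instance Definition _ (B : finType) := Finite.copy (addG B) B.
HB.instance Definition _ (B : finType) := Finite.copy (mulG B) B.

HB.instance Definition _ (B : skewBraceType) := isGroup.Build (addG B)
  (@saddA B) (@sadd0r B) (@saddr0 B) (@saddNr B) (@saddrN B).
HB.instance Definition _ (B : skewBraceType) := isGroup.Build (mulG B)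
  (@smulA B) (@smul1r B) (@smulr1 B) (@smulVr B) (@smulrV B).

(* These two instances let HB derive the [finGroupType] structures. *)
HB.instance Definition _ (B : finSkewBraceType) := Finite.copy (addG B) B.
HB.instance Definition _ (B : finSkewBraceType) := Finite.copy (mulG B) B.

Lemma addG_mul (B : skewBraceType) (x y : addG B) : x * y = (x + y)%SB.
Proof. by []. Qed.

Lemma mulG_mul (B : skewBraceType) (x y : mulG B) : x * y = (x * y)%SB.
Proof. by []. Qed.

Definition lambda (B : skewBraceType) (a b : B) : B := (- a + a * b)%SB.

Definition is_trivial (B : skewBraceType) : Prop :=
  forall a b : B, lambda a b = b.

Definition is_ideal (B : finSkewBraceType) (I : {set B}) : Prop :=
  [/\ group_set (I : {set addG B}), (I : {set addG B}) <| [set: addG B],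
      group_set (I : {set mulG B}), (I : {set mulG B}) <| [set: mulG B]
    & forall a : B, lambda a @: I = I].

Definition is_simple (B : finSkewBraceType) : Prop :=
  (exists a : B, a <> 0%SB) /\
  (forall I : {set B}, is_ideal I -> I = [set 0%SB] \/ I = [set: B]).

Section SkewBraceTheory.
Variable B : skewBraceType.
Implicit Types a b : B.

Lemma saddKr a b : (- a + (a + b))%SB = b.
Proof. by rewrite saddA saddNr sadd0r. Qed.

Lemma sadd_lambda a b : (a + lambda a b)%SB = (a * b)%SB.
Proof. by rewrite /lambda saddA saddrN sadd0r. Qed.

Lemma smul0 a : (a * 0)%SB = a.
Proof.
have /(congr1 (sadd (- (a * 0))%SB)) := @smulD B a 0%SB 0%SB.
rewrite sadd0r -saddA saddKr saddNr => /(congr1 (sadd a)).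
by rewrite saddr0 saddA saddrN sadd0r.
Qed.

Lemma sone_szero : sone = szero :> B.
Proof. by rewrite -[RHS]smul1r smul0. Qed.

Lemma lambdaD a : {morph lambda a : b c / (b + c)%SB}.
Proof. by move=> b c; rewrite /lambda smulD !saddA. Qed.

Lemma lambda0 a : lambda a 0%SB = 0%SB.
Proof. by rewrite /lambda smul0 saddNr. Qed.

End SkewBraceTheory.

(* The wreath product R^T ><| T of the regular action of T on itself. *)
Definition wreath (R T : finGroupType) : Type := ({ffun T -> R} * T)%type.

Section Wreath.
Variables R T : finGroupType.

Definition shift (X : Type) (u : T) (r : {ffun T -> X}) : {ffun T -> X} :=
  [ffun x => r (u^-1 * x)].

Lemma shiftE (X : Type) u (r : {ffun T -> X}) x : shift u r x = r (u^-1 * x).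
Proof. by rewrite ffunE. Qed.

HB.instance Definition _ := Finite.on (wreath R T).

Definition wreath_mul (w w' : wreath R T) : wreath R T :=
  ([ffun x => w.1 x * shift w.2 w'.1 x], w.2 * w'.2).
Definition wreath_one : wreath R T := ([ffun=> 1], 1).
Definition wreath_inv (w : wreath R T) : wreath R T :=
  (shift w.2^-1 [ffun x => (w.1 x)^-1], w.2^-1).

Fact wreath_mulA : associative wreath_mul.
Proof.
move=> [r u] [s v] [t w]; congr pair; last exact: mulgA.
by apply/ffunP=> x; do 3!rewrite ?ffunE ?shiftE /=; rewrite invMg !mulgA.
Qed.
Fact wreath_mul1 : left_id wreath_one wreath_mul.
Proof.
move=> [r u]; congr pair; last exact: mul1g.
by apply/ffunP=> x; do 3!rewrite ?ffunE ?shiftE /=; rewrite invg1 !mul1g.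
Qed.
Fact wreath_mulV : left_inverse wreath_one wreath_inv wreath_mul.
Proof.
move=> [r u]; congr pair; last exact: mulVg.
by apply/ffunP=> x; do 3!rewrite ?ffunE ?shiftE /=; rewrite mulVg.
Qed.

HB.instance Definition _ := Finite_isGroup.Build (wreath R T)
  wreath_mulA wreath_mul1 wreath_mulV.

End Wreath.

Section KernelWreath.
Variables (C : finSkewBraceType) (T : finGroupType).
Hypothesis abT : abelian [set: T].
Variable chi : {morphism [set: mulG C] >-> T}.

Local Notation W := (wreath (mulG C) T).

Definition wact (w : W) (a : {ffun T -> C}) : {ffun T -> C} :=
  [ffun x => (w.1 x + lambda (w.1 x : C) (a (w.2^-1 * x)%g))%SB].

Lemma wact1 a : wact 1 a = a.
Proof.
apply/ffunP=> x; rewrite ffunE /= !sadd_lambda !ffunE invg1 mul1g.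
exact: smul1r.
Qed.

Lemma wactM w w' a : wact (w * w') a = wact w (wact w' a).
Proof.
apply/ffunP=> x; do 3!rewrite ?ffunE ?shiftE ?sadd_lambda /=.
by rewrite invMg !mulgA; symmetry; exact: smulA.
Qed.

Definition eps (w : W) : T := (\prod_(x : T) chi (w.1 x)) * w.2.

Fact epsM : {in [set: W] &, {morph eps : w w' / w * w'}}.
Proof.
move=> [r u] [s v] _ _.
have mulTC : commutative (@mulg T).
  by move=> x y; apply: (centsP abT); rewrite inE.
pose comT : Monoid.com_law (1 : T) :=
  HB.pack (@mulg T) (Monoid.isComLaw.Build T 1 mulg (@mulgA T) mulTC (@mul1g T)).
rewrite /eps /=.
have -> : \prod_x chi ([ffun x0 => r x0 * shift u s x0] x)
    = (\prod_x chi (r x)) * \prod_x chi (s x).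
  under eq_bigr => x _ do rewrite ffunE morphM ?inE //.
  rewrite (big_split comT) /=; congr (_ * _).
  rewrite [RHS](reindex_inj (op := comT) (mulgI u^-1)) /=.
  by apply: eq_bigr => x _; rewrite ffunE.
rewrite -!mulgA; congr (_ * _).
by rewrite mulgA mulgA; congr (_ * _); exact: mulTC.
Qed.

Definition eps_morphism := Morphism epsM.

Definition kerW : {group W} := ('ker eps_morphism)%G.

Definition Pi (g : subg_of kerW) : {ffun T -> C} :=
  [ffun x => (sgval g).1 x].

Lemma wact0 (g : subg_of kerW) : wact (sgval g) [ffun=> 0%SB] = Pi g.
Proof. by apply/ffunP=> x; rewrite !ffunE lambda0 saddr0. Qed.

(* [subg] maps to [kerW] by sending elements outside it to 1; by [Pi_invE] the
   pair below does lie in [kerW]. *)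
Definition Pi_inv (a : {ffun T -> C}) : subg_of kerW :=
  subg kerW ([ffun x => a x], (\prod_(x : T) chi (a x))^-1).

Lemma Pi_invE a :
  sgval (Pi_inv a) = ([ffun x => a x], (\prod_(x : T) chi (a x))^-1).
Proof.
apply: subgK; apply/kerP; rewrite ?inE //= /eps /=.
by under eq_bigr => x _ do rewrite ffunE; rewrite mulgV.
Qed.

Lemma PiK : cancel Pi Pi_inv.
Proof.
move=> g; apply: val_inj; rewrite [LHS]Pi_invE.
case: g => -[r u] /= Gg; have : eps (r, u) = 1 by move/(mker (f := eps_morphism)): Gg.
rewrite /eps /= => /eqP; rewrite -eq_invg_mul => /eqP defu.
congr pair; first by apply/ffunP=> x; rewrite !ffunE.
by rewrite -[RHS]defu; congr (_^-1); apply: eq_bigr => x _; rewrite ffunE.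
Qed.

Lemma Pi_invK : cancel Pi_inv Pi.
Proof. by move=> a; apply/ffunP=> x; rewrite ffunE Pi_invE ffunE. Qed.

Lemma Pi_bij : bijective Pi.
Proof. exact: Bijective PiK Pi_invK. Qed.

Lemma wact_regular (a b : {ffun T -> C}) :
  exists! g : subg_of kerW, wact (sgval g) a = b.
Proof.
have actPi g : wact (sgval g) (Pi (Pi_inv a)) = Pi (g * Pi_inv a).
  by rewrite -!wact0 -wactM.
rewrite Pi_invK in actPi; exists (Pi_inv b * (Pi_inv a)^-1); split.
  by rewrite actPi mulgKV Pi_invK.
by move=> g; rewrite actPi => <-; rewrite PiK mulgK.
Qed.

Definition kmul (a b : {ffun T -> C}) := Pi (Pi_inv a * Pi_inv b).
Definition kone := Pi 1.
Definition kinv (a : {ffun T -> C}) := Pi (Pi_inv a)^-1.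

Fact kmulA : associative kmul.
Proof. by move=> a b c; rewrite /kmul !PiK mulgA. Qed.
Fact kmul1 : left_id kone kmul.
Proof. by move=> a; rewrite /kmul !PiK mul1g Pi_invK. Qed.
Fact kmulr1 : right_id kone kmul.
Proof. by move=> a; rewrite /kmul !PiK mulg1 Pi_invK. Qed.
Fact kmulV : left_inverse kone kinv kmul.
Proof. by move=> a; rewrite /kmul !PiK mulVg. Qed.
Fact kmulrV : right_inverse kone kinv kmul.
Proof. by move=> a; rewrite /kmul !PiK mulgV. Qed.

Definition kadd (a b : {ffun T -> C}) : {ffun T -> C} :=
  [ffun x => (a x + b x)%SB].
Definition kzero : {ffun T -> C} := [ffun=> 0%SB].
Definition kopp (a : {ffun T -> C}) : {ffun T -> C} := [ffun x => (- a x)%SB].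

Fact kaddA : associative kadd.
Proof. by move=> a b c; apply/ffunP=> x; rewrite !ffunE saddA. Qed.
Fact kadd0 : left_id kzero kadd.
Proof. by move=> a; apply/ffunP=> x; rewrite !ffunE sadd0r. Qed.
Fact kaddr0 : right_id kzero kadd.
Proof. by move=> a; apply/ffunP=> x; rewrite !ffunE saddr0. Qed.
Fact kaddN : left_inverse kzero kopp kadd.
Proof. by move=> a; apply/ffunP=> x; rewrite !ffunE saddNr. Qed.
Fact kaddrN : right_inverse kzero kopp kadd.
Proof. by move=> a; apply/ffunP=> x; rewrite !ffunE saddrN. Qed.

Lemma kmulE a b : kmul a b = wact (sgval (Pi_inv a)) b.
Proof. by rewrite -{2}[b]Pi_invK /kmul -!wact0 -wactM. Qed.

Fact kmulD a b c : kmul a (kadd b c) = kadd (kadd (kmul a b) (kopp a)) (kmul a c).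
Proof.
rewrite !kmulE Pi_invE; apply/ffunP=> x; rewrite !ffunE /=.
by rewrite lambdaD -!saddA saddKr.
Qed.

(* The carrier mentions [abT] and [chi] so that the skew brace structure can be
   inferred from it. *)
Definition kernel_wreath : Type :=
  let _ := (abT, chi) in {ffun T -> C}.

HB.instance Definition _ := Finite.copy kernel_wreath {ffun T -> C}.
HB.instance Definition _ := isSkewBrace.Build kernel_wreath
  kaddA kadd0 kaddr0 kaddN kaddrN kmulA kmul1 kmulr1 kmulV kmulrV kmulD.

End KernelWreath.

(* Main.v *)
From HB Require Import structures.
Require Import Defs.
From mathcomp Require Import all_boot all_fingroup.

(** Let [I] be a non-zero ideal of the kernel-wreath skew brace [K], and [x] a
    coordinate at which [I] does not vanish. Constant families lie over [1] in
    [T] (their [chi]-product is a [#|T|]-th power), so they act coordinatewise;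
    hence the projection of [I] to the coordinate [x] and the set [J] of the
    elements of [C] which, placed at [x], lie in [I] are ideals of [C].
    The projection is all of [C]. Suppose [J] is zero. Bracketing [I] with
    elements supported at [x] shows that [(C, +)] is abelian and that
    [ker chi] acts trivially through [lambda]. Then [ker lambda] is an ideal,
    hence zero, so [chi] is injective and [(C, o)] is abelian too. For [a <> 0],
    the image of [b |-> lambda_a(b) - b] is then a non-zero ideal, hence contains
    [- a]; but [lambda_a(b) - b = - a] means [a o b = b], so [a = 0].
    Thus [J = C], and [T] permutes the coordinates transitively. *)

Set Implicit Arguments.
Unset Strict Implicit.

Local Open Scope group_scope.

(** * Cancellation, the lambda map and ideals in a skew brace *)

Section SkewBraceFacts.
Variable B : skewBraceType.
Implicit Types a b c : B.

Lemma sadd_inj a : injective (sadd a).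
Proof. exact: (@mulgI (addG B)). Qed.

Lemma sadd_injr a : injective (fun b => (b + a)%SB).
Proof. exact: (@mulIg (addG B)). Qed.

Lemma smul_inj a : injective (smul a).
Proof. exact: (@mulgI (mulG B)). Qed.

Lemma saddNK a b : (a - b + b)%SB = a.
Proof. exact: (@mulgKV (addG B)). Qed.

Lemma saddNKr a b : (a + (- a + b))%SB = b.
Proof. exact: (@mulKVg (addG B)). Qed.

Lemma smul0r a : (0 * a)%SB = a.
Proof. by rewrite -sone_szero smul1r. Qed.

Lemma lambda0r a : lambda 0%SB a = a.
Proof. by apply: (@sadd_inj 0%SB); rewrite sadd_lambda smul0r sadd0r. Qed.

Lemma lambdaM a b c : lambda (a * b)%SB c = lambda a (lambda b c).
Proof.
apply: (@sadd_inj (a * b)%SB); rewrite sadd_lambda -{2}[(a * b)%SB]sadd_lambda.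
by rewrite -saddA -lambdaD !sadd_lambda smulA.
Qed.

Lemma lambdaN a b : lambda a (- b)%SB = (- lambda a b)%SB.
Proof.
by apply: (@sadd_inj (lambda a b)); rewrite -lambdaD !saddrN lambda0.
Qed.

Lemma lambda_inj a : injective (lambda a).
Proof.
by move=> b c /(congr1 (sadd a)); rewrite !sadd_lambda => /smul_inj.
Qed.

End SkewBraceFacts.

(* Normality in [(B, o)] and in [(B, +)] is phrased without inverses: [c] is the
   conjugate of [a] by [b] exactly when [a b = b c]. *)
Lemma is_idealP (B : finSkewBraceType) (I : {set B}) :
  is_ideal I <->
  [/\ 0%SB \in I,
      forall a b, a \in I -> b \in I -> (a + b)%SB \in I,
      forall a b c, a \in I -> (a + b = b + c)%SB -> c \in I,
      forall a b c, a \in I -> (a * b = b * c)%SB -> c \in I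
    & forall a b, b \in I -> lambda a b \in I].
Proof.
split=> [[gA /andP[_ nA] gM /andP[_ nM] lI]|[I0 ID nA nM lI]].
  have [I0 ID] := group_setP gA; split=> //.
  - move=> a b c Ia def_c.
    have -> : c = (a : addG B) ^ (b : addG B).
      by apply: (@mulgI (addG B) b); rewrite -conjgC; apply: esym.
    by rewrite (@memJ_norm (addG B)) //; apply: (subsetP nA); rewrite inE.
  - move=> a b c Ia def_c.
    have -> : c = (a : mulG B) ^ (b : mulG B).
      by apply: (@mulgI (mulG B) b); rewrite -conjgC; apply: esym.
    by rewrite (@memJ_norm (mulG B)) //; apply: (subsetP nM); rewrite inE.
  - by move=> a b Ib; rewrite -[I](lI a) imset_f.
split.
- by apply/group_setP; split=> // a b; apply: ID.
- apply/andP; split; first exact: subsetT.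
  apply/subsetP=> b _; rewrite inE; apply/subsetP=> _ /imsetP[a Ia ->].
  by apply: (nA a b) => //; apply: (@conjgC (addG B)).
- apply/group_setP; split=> [|a b Ia Ib]; first by move: I0; rewrite -sone_szero.
  by rewrite mulG_mul -sadd_lambda; apply: ID => //; apply: lI.
- apply/andP; split; first exact: subsetT.
  apply/subsetP=> b _; rewrite inE; apply/subsetP=> _ /imsetP[a Ia ->].
  by apply: (nM a b) => //; apply: (@conjgC (mulG B)).
- move=> a; apply/eqP.
  (* As [lambda a] is injective and [I] finite, the inclusion of the image in [I] suffices. *)
  rewrite eqEcard card_imset ?leqnn ?andbT; last exact: lambda_inj.
  by apply/subsetP=> _ /imsetP[b Ib ->]; apply: lI.
Qed.

Section Ideals.
Variables (B : finSkewBraceType) (I : {set B}).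
Hypothesis idI : is_ideal I.

Lemma ideal0 : 0%SB \in I.
Proof. by case/is_idealP: idI. Qed.

Lemma idealD a b : a \in I -> b \in I -> (a + b)%SB \in I.
Proof. by case/is_idealP: idI => _ + _ _ _; apply. Qed.

Lemma idealN a : a \in I -> (- a)%SB \in I.
Proof. by case: idI => gA _ _ _ _; apply: (@groupVr _ (Group gA)). Qed.

Lemma ideal_addJ a b c : a \in I -> (a + b = b + c)%SB -> c \in I.
Proof. by case/is_idealP: idI => _ _ + _ _; apply. Qed.

Lemma ideal_mulJ a b c : a \in I -> (a * b = b * c)%SB -> c \in I.
Proof. by case/is_idealP: idI => _ _ _ + _; apply. Qed.

Lemma ideal_lambda a b : b \in I -> lambda a b \in I.
Proof. by case/is_idealP: idI => _ _ _ _; apply. Qed.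

End Ideals.

Lemma is_simple_ideal (B : finSkewBraceType) (I : {set B}) a :
  is_simple B -> is_ideal I -> a \in I -> a <> 0%SB -> I = [set: B].
Proof.
by case=> _ sB /sB[] // -> /set1P.
Qed.

(** * Skew braces with commutative addition *)

Section CommutativeAddition.
Variable B : finSkewBraceType.
Hypothesis addC : forall a b : B, (a + b = b + a)%SB.

(** The two operations agree when the left factor lies in the kernel, so closure under [+] follows
    from multiplicativity of [lambda]. *)
Lemma lambda_ker_ideal :
  is_ideal [set a : B | [forall b, lambda a b == b]].
Proof.
have kerP (a : B) : reflect (forall b, lambda a b = b)
    (a \in [set a : B | [forall b, lambda a b == b]]).
  by rewrite inE; apply: (iffP forallP) => H b; apply/eqP.
have kerJ (a b c : B) : (forall d, lambda a d = d) -> (a * b = b * c)%SB ->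
    forall d, lambda c d = d.
  move=> a1 def_c d; apply: (@lambda_inj _ b).
  by rewrite -lambdaM -def_c lambdaM a1.
apply/is_idealP; split.
- by apply/kerP=> b; rewrite lambda0r.
- move=> a b /kerP a1 /kerP b1; apply/kerP=> c.
  by rewrite -[X in (_ + X)%SB]a1 sadd_lambda lambdaM b1 a1.
- by move=> a b c Ka; rewrite addC => /sadd_inj <-.
- by move=> a b c /kerP a1 def_c; apply/kerP; apply: kerJ def_c.
- move=> a b /kerP b1; apply/kerP.
  apply: (@kerJ b (sinv a)) => //; apply: (@smul_inj _ a).
  rewrite !smulA smulrV smul1r.
  (* The conjugate [a * b * sinv a] lies in the kernel, so adding [a] to it gives [a * b]; hence it
     equals [lambda a b]. *)
  have def_ab : (a * b = lambda a b + a)%SB by rewrite addC sadd_lambda.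
  have b'1 : forall d, lambda (a * b * sinv a)%SB d = d.
    by move=> d; rewrite !lambdaM b1 -lambdaM smulrV sone_szero lambda0r.
  apply: (@sadd_injr _ a); rewrite -def_ab.
  by rewrite -[X in (_ + X)%SB]b'1 sadd_lambda -smulA smulVr smulr1.
Qed.

Hypothesis mulC : forall a b : B, (a * b = b * a)%SB.

(** The set is the image of an additive endomorphism; it is stable under every [lambda c] because
    [lambda a] and [lambda c] commute. *)
Lemma lambda_sub_ideal (a : B) :
  is_ideal [set (lambda a b - b)%SB | b : B].
Proof.
apply/is_idealP; split.
- by apply/imsetP; exists 0%SB; rewrite // lambda0 saddrN.
- move=> _ _ /imsetP[b _ ->] /imsetP[c _ ->]; apply/imsetP.
  exists (c + b)%SB => //; rewrite lambdaD [LHS]addC.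
  have -> : (- (c + b) = - b - c)%SB by apply: (@invMg (addG B)).
  move: (lambda a b) (lambda a c) => b1 c1.
  by rewrite -!saddA; congr (_ + _)%SB; rewrite [LHS]addC -saddA.
- by move=> c b d Ic; rewrite addC => /sadd_inj <-.
- by move=> c b d Ic; rewrite mulC => /smul_inj <-.
- move=> c _ /imsetP[b _ ->]; apply/imsetP; exists (lambda c b) => //.
  by rewrite lambdaD lambdaN -!lambdaM mulC.
Qed.

Lemma simple_commutative_trivial : is_simple B -> is_trivial B.
Proof.
move=> simpB a; suff a1 : [forall b, lambda a b == b].
  by move=> b; apply/eqP/(forallP a1).
apply/negPn/negP=> /forallPn[b /eqP nt_ab].
pose I := [set (lambda a b - b)%SB | b : B].
have I_T : I = [set: B].
  have Iid := lambda_sub_ideal a.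
  apply: (is_simple_ideal (a := (lambda a b - b)%SB) simpB Iid) => [|ab0].
    by apply: imset_f; rewrite inE.
  by apply: nt_ab; apply: (@sadd_injr _ (- b)%SB); rewrite ab0 saddrN.
have /imsetP[c _ /(congr1 (sadd a))] : (- a)%SB \in I by rewrite I_T inE.
rewrite saddrN saddA sadd_lambda => /esym/(congr1 (fun d => d + c)%SB).
rewrite saddNK sadd0r -[RHS]smul0r => /(@mulIg (mulG B)) a0.
by apply: nt_ab; rewrite a0 lambda0r.
Qed.

End CommutativeAddition.

(** * Coordinate formulas in the kernel-wreath skew brace *)

Section KernelWreathIdeals.
Variables (C : finSkewBraceType) (T : finGroupType).
Hypothesis abT : abelian [set: T].
Variable chi : {morphism [set: mulG C] >-> T}.

Local Notation K := (kernel_wreath abT chi).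
Implicit Types (a b : {ffun T -> C}) (c d : C) (x y : T).

(** The element of [kerW] over [a] has [T]-component [(chi_prod a)^-1], so multiplying by [a] on the
    left reads the other factor at [chi_prod a * x]. *)
Definition chi_prod a : T := \prod_x chi (a x).

Lemma kernel_wreath_addE (a b : K) x :
  ((a + b)%SB : {ffun T -> C}) x
    = ((a : {ffun T -> C}) x + (b : {ffun T -> C}) x)%SB.
Proof. by rewrite ffunE. Qed.

Lemma kernel_wreath_oppE (a : K) x :
  ((- a)%SB : {ffun T -> C}) x = (- (a : {ffun T -> C}) x)%SB.
Proof. by rewrite ffunE. Qed.

Lemma kernel_wreath_mulE (a b : K) x :
  ((a * b)%SB : {ffun T -> C}) x
    = ((a : {ffun T -> C}) x * (b : {ffun T -> C}) (chi_prod a * x)%g)%SB.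
Proof.
rewrite [(a * b)%SB](@kmulE C T abT chi) ffunE Pi_invE /= ffunE invgK.
exact: sadd_lambda.
Qed.

Lemma kernel_wreath_lambdaE (a b : K) x :
  (lambda a b : {ffun T -> C}) x
    = lambda ((a : {ffun T -> C}) x) ((b : {ffun T -> C}) (chi_prod a * x)).
Proof.
by rewrite kernel_wreath_addE kernel_wreath_oppE kernel_wreath_mulE.
Qed.

Lemma chi0 : chi 0%SB = 1.
Proof. by rewrite -sone_szero; apply: morph1. Qed.

Definition const_fam c : {ffun T -> C} := [ffun=> c].

Definition single x c : {ffun T -> C} :=
  [ffun y => if y == x then c else 0%SB].

Lemma chi_prod_const c : chi_prod (const_fam c) = 1.
Proof.
rewrite /chi_prod; under eq_bigr do rewrite ffunE.
rewrite big_const -Monoid.iteropE -/(chi c ^+ _) -cardsT.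
have /dvdnP[k ->] : #[chi c] %| #|[set: T]| by rewrite orderE cardSg ?subsetT.
by rewrite mulnC expgM expg_order expg1n.
Qed.

Lemma chi_prod_single x c : chi_prod (single x c) = chi c.
Proof.
(* Isolating the factor at [x] with [bigD1] requires a commutative law, built here from [abT]. *)
have mulTC : commutative (@mulg T).
  by move=> y z; apply: (centsP abT); rewrite inE.
pose comT : Monoid.com_law (1 : T) := HB.pack (@mulg T)
  (Monoid.isComLaw.Build T 1 mulg (@mulgA T) mulTC (@mul1g T)).
rewrite /chi_prod (bigD1 (op := comT) x) //= ffunE eqxx.
by rewrite [X in _ * X]big1 ?mulg1 // => y /negPf nyx; rewrite ffunE nyx chi0.
Qed.

Lemma const_mulE c (b : K) x :
  (((const_fam c : K) * b)%SB : {ffun T -> C}) x = (c * (b : {ffun T -> C}) x)%SB.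
Proof. by rewrite kernel_wreath_mulE chi_prod_const mul1g ffunE. Qed.

Lemma mul_constE (b : K) c x :
  ((b * (const_fam c : K))%SB : {ffun T -> C}) x = ((b : {ffun T -> C}) x * c)%SB.
Proof. by rewrite kernel_wreath_mulE ffunE. Qed.

Lemma lambda_constE c (b : K) x :
  (lambda (const_fam c : K) b : {ffun T -> C}) x = lambda c ((b : {ffun T -> C}) x).
Proof. by rewrite kernel_wreath_lambdaE chi_prod_const mul1g ffunE. Qed.

(** * Projections and fibers of an ideal *)

Variable I : {set K}.
Hypothesis idI : is_ideal I.

Definition ideal_proj x : {set C} := [set (a : {ffun T -> C}) x | a : K in I].

Definition ideal_fiber x : {set C} := [set c | (single x c : K) \in I].

Lemma ideal_proj_ideal x : is_ideal (ideal_proj x).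
Proof.
apply/is_idealP; split.
- by apply/imsetP; exists 0%SB; rewrite ?(ideal0 idI) // ffunE.
- move=> _ _ /imsetP[a Ia ->] /imsetP[b Ib ->]; apply/imsetP.
  by exists (a + b)%SB; rewrite ?(idealD idI) // kernel_wreath_addE.
- move=> _ c d /imsetP[a Ia ->] def_d; apply/imsetP.
  (* The conjugate of the whole family [a] by [const_fam c]; its value at [x] is [d]. *)
  exists [ffun y => - c + ((a : {ffun T -> C}) y + c)]%SB.
    apply: (ideal_addJ idI (b := const_fam c) Ia); apply/ffunP=> y.
    by rewrite !kernel_wreath_addE !ffunE saddNKr.
  by rewrite ffunE def_d saddKr.
- move=> _ c d /imsetP[a Ia ->] def_d; apply/imsetP.
  exists [ffun y => sinv c * ((a : {ffun T -> C}) y * c)]%SB.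
    apply: (ideal_mulJ idI (b := const_fam c) Ia); apply/ffunP=> y.
    by rewrite mul_constE const_mulE ffunE smulA smulrV smul1r.
  by rewrite ffunE def_d smulA smulVr smul1r.
- move=> c _ /imsetP[a Ia ->]; apply/imsetP.
  exists (lambda (const_fam c : K) a); first exact: ideal_lambda.
  by rewrite lambda_constE.
Qed.

(** Conjugation and [lambda] by constant families fix every zero coordinate, hence preserve support
    at [x]. *)
Lemma ideal_fiber_ideal x : is_ideal (ideal_fiber x).
Proof.
apply/is_idealP; split.
- rewrite inE; suff -> : single x 0%SB = (0%SB : K) by apply: ideal0.
  by apply/ffunP=> y; rewrite !ffunE if_same.
- move=> c d; rewrite !inE => Ic Id.
  suff -> : single x (c + d)%SB = ((single x c : K) + single x d)%SB.
    exact: idealD.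
  apply/ffunP=> y; rewrite kernel_wreath_addE !ffunE.
  by case: eqP; rewrite ?sadd0r.
- move=> c d e; rewrite !inE => Ic def_e.
  apply: (ideal_addJ idI (b := const_fam d) Ic); apply/ffunP=> y.
  by rewrite !kernel_wreath_addE !ffunE; case: eqP; rewrite ?sadd0r ?saddr0.
- move=> c d e; rewrite !inE => Ic def_e.
  apply: (ideal_mulJ idI (b := const_fam d) Ic); apply/ffunP=> y.
  by rewrite mul_constE const_mulE !ffunE; case: eqP; rewrite ?smul0r ?smul0.
- move=> c d; rewrite !inE => Id.
  suff -> : single x (lambda c d) = lambda (const_fam c : K) (single x d).
    exact: ideal_lambda.
  apply/ffunP=> y; rewrite lambda_constE !ffunE.
  by case: eqP; rewrite ?lambda0.
Qed.

(** As [chi c = 1], [single x c] moves no coordinate and acts as the identity away from [x], where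
    the difference therefore vanishes. *)
Lemma ideal_fiber_lambda x c d :
  chi c = 1 -> d \in ideal_proj x -> (lambda c d - d)%SB \in ideal_fiber x.
Proof.
move=> chic1 /imsetP[a Ia ->]; rewrite inE.
suff -> : single x (lambda c ((a : {ffun T -> C}) x) - (a : {ffun T -> C}) x)%SB
    = (lambda (single x c : K) a - a)%SB.
  by apply: idealD; rewrite ?idealN ?ideal_lambda.
apply/ffunP=> y; rewrite kernel_wreath_addE kernel_wreath_oppE.
rewrite kernel_wreath_lambdaE chi_prod_single chic1 mul1g !ffunE.
by case: eqP => [->|_] //; rewrite lambda0r; apply/esym/saddrN.
Qed.

(** An additive commutator with a family supported at [x] is itself supported at [x]. *)
Lemma ideal_fiber_comm x c d :
  c \in ideal_proj x -> (- c + (- d + (c + d)))%SB \in ideal_fiber x.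
Proof.
move=> /imsetP[a Ia ->]; rewrite inE; set b : K := single x d.
suff -> : single x (- (a : {ffun T -> C}) x + (- d + ((a : {ffun T -> C}) x + d)))%SB
    = (- a + (- b + (a + b)))%SB.
  apply: (idealD idI); first exact: idealN.
  by apply: (ideal_addJ idI (b := b) Ia); rewrite saddNKr.
apply/ffunP=> y; rewrite !(kernel_wreath_addE, kernel_wreath_oppE) !ffunE.
case: eqP => [->|_] //.
by rewrite saddr0 -[X in (_ + (_ + X))%SB]sadd0r saddKr saddNr.
Qed.

(** The action of [single x d] carries the support from [chi d * x] to [x]; this links different
    fibers. *)
Lemma ideal_fiber_shift x c d :
  c \in ideal_fiber (chi d * x) -> lambda d c \in ideal_fiber x.
Proof.
rewrite !inE => Ic.
suff -> : single x (lambda d c) = lambda (single x d : K) (single (chi d * x) c).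
  exact: ideal_lambda.
apply/ffunP=> y; rewrite kernel_wreath_lambdaE chi_prod_single !ffunE.
by rewrite (inj_eq (mulgI _)); case: eqP => // _; rewrite lambda0.
Qed.

Lemma ideal_fiber_full :
  (forall x, ideal_fiber x = [set: C]) -> I = [set: K].
Proof.
move=> full; apply/setP=> a; rewrite inE.
pose trunc (s : seq T) : K :=
  [ffun y => if y \in s then (a : {ffun T -> C}) y else 0%SB].
(* The family [a] is assembled one coordinate at a time; [uniq] ensures that no value is added
   twice. *)
suff Itrunc s : uniq s -> trunc s \in I.
  rewrite (_ : a = trunc (enum T)) ?Itrunc ?enum_uniq //.
  by apply/ffunP=> y; rewrite ffunE mem_enum.
elim: s => [_|x s IHs /= /andP[sx /IHs Is]].
  suff -> : trunc [::] = 0%SB by apply: ideal0.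
  by apply/ffunP=> y; rewrite !ffunE.
have : (a : {ffun T -> C}) x \in ideal_fiber x by rewrite full inE.
rewrite inE => /(idealD idI) /(_ Is); congr (_ \in I).
apply/ffunP=> y; rewrite kernel_wreath_addE !ffunE inE.
by case: eqP => [->|_]; rewrite ?(negPf sx) ?saddr0 ?sadd0r.
Qed.

End KernelWreathIdeals.

Theorem theoremC (C : finSkewBraceType) (T : finGroupType)
    (abT : abelian [set: T]) (chi : {morphism [set: mulG C] >-> T})
    (simpleC : is_simple C) (nontrivC : ~ is_trivial C)
    (ntT : [set: T] != 1)
    (chi_surj : chi @* [set: mulG C] = [set: T]) :
  is_simple (kernel_wreath abT chi).
Proof.
split=> [|I idI].
  have [[c nz_c] _] := simpleC; exists (const_fam T c).
  by move/ffunP/(_ 1); rewrite !ffunE.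
have [I0|] := boolP (I \subset [set 0%SB]).
  left; apply/eqP; rewrite eqEsubset I0 sub1set; exact: ideal0.
case/subsetPn=> a Ia; rewrite inE => nz_a; right.
have /existsP[x /eqP nz_ax] : [exists x, (a : {ffun T -> C}) x != 0%SB].
  apply: contraNT nz_a => /existsPn a0; apply/eqP/ffunP=> x.
  by rewrite ffunE; apply/eqP; rewrite -[_ == _]negbK a0.
have proj_full : ideal_proj I x = [set: C].
  apply: (is_simple_ideal simpleC (ideal_proj_ideal idI x) _ nz_ax).
  by apply/imsetP; exists a.
have fiber_full : ideal_fiber I x = [set: C].
  have [_ /(_ _ (ideal_fiber_ideal idI x))[fib0|//]] := simpleC.
  case: nontrivC.
  have addC (c d : C) : (c + d = d + c)%SB.
    have : (- c + (- d + (c + d)))%SB \in ideal_fiber I x.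
      by apply: ideal_fiber_comm; rewrite // proj_full inE.
    rewrite fib0 inE => /eqP/(congr1 (sadd c)); rewrite saddNKr saddr0.
    by move/(congr1 (sadd d)); rewrite saddNKr.
  have lam_ker (c : C) : chi c = 1 -> forall d, lambda c d = d.
    move=> chic1 d; have : (lambda c d - d)%SB \in ideal_fiber I x.
      by apply: ideal_fiber_lambda; rewrite // proj_full inE.
    rewrite fib0 inE => /eqP/(congr1 (fun e => e + d)%SB).
    by rewrite saddNK sadd0r.
  (* If the kernel of [lambda] is everything, [C] is trivial at once; otherwise it is zero and [chi]
     embeds [(C, o)] in [T]. *)
  have [_ /(_ _ (lambda_ker_ideal addC))[ker0|kerT]] := simpleC; last first.
    move=> c; have : c \in [set: C] by rewrite inE.
    by rewrite -kerT inE => /forallP c1 d; apply/eqP.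
  apply: simple_commutative_trivial => // c d.
  have ker1 (e : C) : chi e = 1 -> e = sone.
    move=> /lam_ker e1; rewrite sone_szero; apply/set1P; rewrite -ker0 inE.
    by apply/forallP=> b; rewrite e1.
  have inj_chi : 'injm chi.
    by apply/subsetP=> e /mker/ker1 ->; rewrite inE.
  apply: (injmP inj_chi); rewrite ?inE //.
  by rewrite !morphM ?inE //; apply: (centsP abT); rewrite inE.
apply: (ideal_fiber_full idI) => y; apply/setP=> e; rewrite [RHS]inE.
(* A preimage [d] satisfies [chi d * y = x], so the full fiber at [x] is carried to [y]. *)
have : x * y^-1 \in chi @* [set: mulG C] by rewrite chi_surj inE.
case/morphimP=> d _ _ def_xy.
(* Writes [e] as [lambda d] of [lambda (sinv d) e], the form required by [ideal_fiber_shift]. *)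
rewrite -[e]lambda0r -sone_szero -(smulrV d) lambdaM.
by apply: ideal_fiber_shift => //; rewrite -def_xy mulgKV fiber_full inE.
Qed.
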